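(* For all matrices $E,A\in\mathbb{R}^{c\times n}$ and $B\in\mathbb{R}^{c\times m}$ there exists an ODE-LTI system $\mathscr{S}=(A_l,B_l,C_l,D_l)$ associated with the DAE-LTI $\frac{d(Ex(t))}{dt}=Ax(t)+Bu(t)$.
   Context: Throughout, matrices are real. An interval is a set $I\subseteq\mathbb{R}$ of the form $\mathbb{R}$, $[a,+\infty)$, $(-\infty,a]$ or $[a,b]$ with $a<b$. $L^1_{loc}(I,\mathbb{R}^q)$ is the set of measurable $f:I\to\mathbb{R}^q$ that are Lebesgue integrable on every compact interval $K\subseteq I$. $AC(I,\mathbb{R}^q)$ is the set of absolutely continuous functions $I\to\mathbb{R}^q$ (for unbounded $I$: absolutely continuous on every compact subinterval). ''a.e.'' means almost everywhere with respect to Lebesgue measure. A solution of the DAE-LTI $\frac{d(Ex(t))}{dt}=Ax(t)+Bu(t)$ on $I$ is a pair $(x,u)\in L^1_{loc}(I,\mathbb{R}^n)\times L^1_{loc}(I,\mathbb{R}^m)$ such that $Ex$ is absolutely continuous and $Ex(t)=Ex(t_0)+\int_{t_0}^t(Ax(s)+Bu(s))\,ds$ for all $t_0,t\in I$, $t\ge t_0$. $\mathcal{B}_I(E,A,B)$ is the set of all solutions on $I$, viewed also as a subset of $L^1_{loc}(I,\mathbb{R}^{n+m})$ by stacking $x$ and $u$. An ODE-LTI $(\widetilde A,G,\widetilde C,\widetilde D)$ with $\widetilde A\in\mathbb{R}^{r\times r}$, $G\in\mathbb{R}^{r\times s}$, $\widetilde C\in\mathbb{R}^{q\times r}$, $\widetilde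 D\in\mathbb{R}^{q\times s}$ is the system $\dot p=\widetilde Ap+Gw$, $z=\widetilde Cp+\widetilde Dw$. It is a realization of a set $\mathcal{B}\subseteq L^1_{loc}(I,\mathbb{R}^q)$ if (1) for every $z\in\mathcal{B}$ there exist $p\in AC(I,\mathbb{R}^r)$, $w\in L^1_{loc}(I,\mathbb{R}^s)$ with $\dot p=\widetilde Ap+Gw$ a.e. and $z=\widetilde Cp+\widetilde Dw$ a.e.; and (2) whenever $(p,w)\in AC(I,\mathbb{R}^r)\times L^1_{loc}(I,\mathbb{R}^s)$ satisfies $\dot p=\widetilde Ap+Gw$ a.e., there is $z\in\mathcal{B}$ with $z=\widetilde Cp+\widetilde Dw$ a.e. An ODE-LTI $(A_l,B_l,C_l,D_l)$ with $A_l\in\mathbb{R}^{\hat n\times\hat n}$, $B_l\in\mathbb{R}^{\hat n\times k}$, $C_l\in\mathbb{R}^{(n+m)\times\hat n}$, $D_l\in\mathbb{R}^{(n+m)\times k}$, $\hat n\le n$ ($\hat n=0$ allowed, with the usual conventions for empty matrices), is associated with the DAE-LTI if: (1) either $D_l=0$, $B_l=0$ and $k=1$, or $\mathrm{Rank}\,D_l=k$; (2) if $C_s,D_s$ denote the matrices formed by the first $n$ rows of $C_l,D_l$, then $ED_s=0$ and $\mathrm{Rank}\,EC_s=\hat n$; (3) $(A_l,B_l,C_l,D_l)$ is a realization of $\mathcal{B}_I(E,A,B)$ for every interval $I$. *)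

(* Defs.v *)
From HB Require Import structures.
From mathcomp Require Import all_boot all_order all_algebra.
From mathcomp Require Import all_classical all_reals all_analysis.

Set Implicit Arguments.
Unset Strict Implicit.
Unset Printing Implicit Defensive.

Import Order.TTheory GRing.Theory Num.Theory.
Import numFieldNormedType.Exports.

Local Open Scope classical_set_scope.
Local Open Scope ring_scope.

(* Functions on an interval I are total functions on R whose values outside I
   are irrelevant: every predicate below only constrains the values on I. *)

(* The real line with the Lebesgue (i.e. completed Borel) sigma-algebra; it is
   the domain of [completed_lebesgue_measure]. *)
Definition lebesgueR (R : realType) : measurableType _ :=
  caratheodory_type ((wlength (R := R) idfun)^*)%mu.

Local Notation leb := completed_lebesgue_measure.

Definition time_interval (R : realType) (I : set R) : Prop :=
  [\/ I = setT,
      exists a : R, I = `[a, +oo[%classic,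
      exists a : R, I = `]-oo, a]%classic |
      exists a b : R, a < b /\ I = `[a, b]%classic].

Definition L1loc (R : realType) (I : set R) (q : nat) (f : R -> 'cV[R]_q)
    : Prop :=
  forall i : 'I_q,
    measurable_fun (T := lebesgueR R) I (fun t => f t i 0) /\
    (forall a b : R, `[a, b]%classic `<=` I ->
       (@leb R).-integrable `[a, b] (fun t => (f t i 0)%:E)).

Definition abs_cont_itv (R : realType) (q : nat) (a b : R) (f : R -> 'cV[R]_q)
    : Prop :=
  forall e : R, 0 < e -> exists2 d : R, 0 < d &
    forall (N : nat) (l r : 'I_N -> R),
      (forall j, a <= l j /\ l j <= r j /\ r j <= b) ->
      trivIset setT (fun j => `]l j, r j[%classic) ->
      \sum_(j < N) (r j - l j) < d ->
      \sum_(j < N) `|f (r j) - f (l j)| < e.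

(* For compact I this is absolute continuity on I itself, since [abs_cont_itv]
   is inherited by subintervals. *)
Definition abs_cont (R : realType) (I : set R) (q : nat) (f : R -> 'cV[R]_q) : Prop :=
  forall a b : R, `[a, b]%classic `<=` I -> abs_cont_itv a b f.

Definition vintegral (R : realType) (q : nat) (D : set R) (f : R -> 'cV[R]_q)
    : 'cV[R]_q :=
  \col_(i < q) \int[@leb R]_(s in D) (f s i 0).

Definition dae_solutions (R : realType) (c n m : nat) (I : set R)
    (E A : 'M[R]_(c, n)) (B : 'M[R]_(c, m))
    : set ((R -> 'cV[R]_n) * (R -> 'cV[R]_m)) :=
  [set xu | [/\ L1loc I xu.1, L1loc I xu.2,
      abs_cont I (fun t => E *m xu.1 t) &
      forall t0 t : R, I t0 -> I t -> t0 <= t ->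
        E *m xu.1 t = E *m xu.1 t0
          + vintegral `[t0, t] (fun s => A *m xu.1 s + B *m xu.2 s)]].

Definition dae_behavior (R : realType) (c n m : nat) (I : set R)
    (E A : 'M[R]_(c, n)) (B : 'M[R]_(c, m)) : set (R -> 'cV[R]_(n + m)) :=
  [set (fun t => col_mx (xu.1 t) (xu.2 t)) | xu in dae_solutions I E A B].

Record odeLTI (R : realType) (r s q : nat) := OdeLTI {
  odeA : 'M[R]_r;
  odeB : 'M[R]_(r, s);
  odeC : 'M[R]_(q, r);
  odeD : 'M[R]_(q, s) }.

Definition ode_state (R : realType) (r s q : nat) (S : odeLTI R r s q)
    (I : set R) (p : R -> 'cV[R]_r) (w : R -> 'cV[R]_s) : Prop :=
  [/\ abs_cont I p, L1loc I w &
      {ae @leb R, forall t : R, I t ->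
        is_derive t (1 : R) p (odeA S *m p t + odeB S *m w t)}].

Definition ode_output (R : realType) (r s q : nat) (S : odeLTI R r s q)
    (I : set R) (p : R -> 'cV[R]_r) (w : R -> 'cV[R]_s) (z : R -> 'cV[R]_q)
    : Prop :=
  {ae @leb R, forall t : R, I t -> z t = odeC S *m p t + odeD S *m w t}.

Definition realization (R : realType) (r s q : nat) (S : odeLTI R r s q)
    (I : set R) (Bh : set (R -> 'cV[R]_q)) : Prop :=
  (forall z, Bh z -> exists p w, ode_state S I p w /\ ode_output S I p w z) /\
  (forall p w, ode_state S I p w -> exists z, Bh z /\ ode_output S I p w z).

(* The number k of inputs is positive: this is why the case B_l = 0, D_l = 0
   is recorded with k = 1.  The number nh of states may be 0. *)
Definition associated (R : realType) (c n m nh k : nat)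
    (E A : 'M[R]_(c, n)) (B : 'M[R]_(c, m)) (S : odeLTI R nh k (n + m))
    : Prop :=
  let Cs : 'M[R]_(n, nh) := usubmx (odeC S) in
  let Ds : 'M[R]_(n, k) := usubmx (odeD S) in
  [/\ (nh <= n)%N /\ (0 < k)%N,
      [/\ odeD S = 0, odeB S = 0 & k = 1%N] \/ \rank (odeD S) = k,
      E *m Ds = 0 /\ \rank (E *m Cs) = nh &
      forall I : set R, time_interval I ->
        realization S I (dae_behavior I E A B)].

(* Main.v *)
Require Import Defs.
From mathcomp Require Import all_boot all_order all_algebra.
From mathcomp Require Import all_classical all_reals all_analysis.
From mathcomp Require Import measurable_realfun lra.

(** The proof identifies the subspace of all consistent values of E x and
    parametrizes the solutions over it.

    Write z = (x, u).  For a subspace V of R^c let Phi(V) be the set of all E x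
    such that A x + B u lies in V ([pred_space]).  If every solution on every
    interval has E x(t) in V at all times, then the derivative A x + B u of E x
    is in V almost everywhere, hence E x(t) is in Phi(V) almost everywhere, and
    then everywhere because E x is continuous ([consistent_pred_space]).
    Intersecting V with Phi(V) as long as the rank drops yields a V that
    contains E x(t) for all solutions and satisfies V <= Phi(V)
    ([exists_consistent_space]).

    The inclusion V <= Phi(V) says that each y in V has a preimage K y = (x, u),
    linear in y, with E x = y and A x + B u in V.  Let p be the coordinates of
    E x in a basis of V, let C be K written in this basis, and let the columns
    of D be a basis of the space of all (x, u) with E x = 0 and A x + B u in V.
    Every solution is then almost everywhere of the form C p + D w, where w is
    obtained from a left inverse of D, and A_l, B_l are the coordinates in V of
    the maps [A B] C and [A B] D ([realization_matrices]).

    It remains to pass between the integral form of the DAE and the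
    almost-everywhere differential form of the ODE.  One direction is the
    Lebesgue differentiation theorem ([primitive_is_derive]), transported from
    Borel functions to Lebesgue measurable ones by changing the function on a
    null set ([Borel_version]).  The other one is the fundamental theorem of
    calculus for absolutely continuous functions ([ac_ftc]), which reduces to
    the fact that an absolutely continuous function with almost everywhere
    vanishing derivative is constant ([ac_derive0_eq]).  The latter is proved
    by a Cousin partition argument: the exceptional null set is covered by an
    open set of small measure, the interval is cut into pieces that either lie
    in this open set or on which the increment is at most a small multiple of
    the length, and absolute continuity bounds the contribution of the pieces
    of the first kind. *)

Set Implicit Arguments.
Unset Strict Implicit.
Unset Printing Implicit Defensive.
Import Order.TTheory GRing.Theory Num.Theory.
Import numFieldNormedType.Exports.
Local Open Scope classical_set_scope.
Local Open Scope ring_scope.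
Local Notation leb := completed_lebesgue_measure.

(** * Linear algebra *)

Section Algebra.
Variable F : fieldType.

(** The predecessor space Phi(V): for row vectors z in F^p, the set of all z M
    such that z N lies in V.  Subspaces are row spaces; the generator <<_>> only
    turns the p x c matrix spanning Phi(V) into a square one. *)
Definition pred_space (p c : nat) (M N : 'M[F]_(p, c)) (V : 'M[F]_c) : 'M[F]_c :=
  (<<kermx (N *m cokermx V) *m M>>)%MS.

Lemma sub_pred_space (p c : nat) (M N : 'M[F]_(p, c)) (V : 'M[F]_c)
    (z : 'rV[F]_p) :
  (z *m N <= V)%MS -> (z *m M <= pred_space M N V)%MS.
Proof.
move=> zV; rewrite /pred_space genmxE submxMr //.
by rewrite sub_kermx mulmxA -submxE.
Qed.

(** If a property of subspaces holds for the whole space and is preserved by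
    V |-> V :&: Phi(V), then it holds for some V contained in Phi(V): the rank
    cannot drop forever. *)
Lemma exists_invariant_space (p c : nat) (M N : 'M[F]_(p, c)) (P : 'M[F]_c -> Prop) :
  P 1%:M -> (forall V, P V -> P (V :&: pred_space M N V)%MS) ->
  exists V, P V /\ (V <= pred_space M N V)%MS.
Proof.
move=> P1 PI.
suff H : forall r V, P V -> (\rank V <= r)%N ->
    exists V, P V /\ (V <= pred_space M N V)%MS.
  by apply: (H c _ P1); rewrite rank_leq_row.
elim=> [|r IH] V PV rV.
  exists V; split=> //; move: rV; rewrite leqn0 mxrank_eq0 => /eqP ->.
  exact: sub0mx.
have [sV|nsV] := boolP (V <= pred_space M N V)%MS; first by exists V.
apply: (IH (V :&: pred_space M N V)%MS); first exact: PI.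
rewrite -ltnS (leq_trans _ rV) // ltn_neqAle mxrankS ?capmxSl // andbT.
apply: contra nsV => /eqP rE.
have [_] := mxrank_leqif_sup (capmxSl V (pred_space M N V)).
by rewrite rE eqxx => /esym; rewrite sub_capmx submx_refl.
Qed.

(** The linear algebra of the construction, in terms of columns z = (x, u).
    The witnesses are chosen so that the columns of E C_s, with C_s the upper
    part [usubmx C], are a basis of V, Q gives coordinates in this basis, and W
    is a left inverse of D unless D = 0.  The last clause says that each z with
    E x and A x + B u in V is determined by the coordinates of E x and a
    component along D. *)
Lemma realization_matrices (c n m : nat) (E A : 'M[F]_(c, n)) (B : 'M[F]_(c, m))
    (V : 'M[F]_c) :
  (V <= pred_space (row_mx E 0 : 'M[F]_(c, n + m))^T (row_mx A B)^T V)%MS ->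
  exists (nh k : nat) (Al : 'M[F]_nh) (Bl : 'M[F]_(nh, k))
    (C : 'M[F]_(n + m, nh)) (D : 'M[F]_(n + m, k))
    (Q : 'M[F]_(nh, c)) (W : 'M[F]_(k, n + m)),
  [/\ (0 < k)%N, [/\ D = 0, Bl = 0 & k = 1%N] \/ \rank D = k,
      E *m usubmx D = 0, Q *m (E *m usubmx C) = 1%:M &
    [/\ row_mx A B *m C = E *m usubmx C *m Al,
        row_mx A B *m D = E *m usubmx C *m Bl &
        forall z : 'cV[F]_(n + m),
          ((E *m usubmx z)^T <= V)%MS -> ((row_mx A B *m z)^T <= V)%MS ->
          z = C *m (Q *m (E *m usubmx z))
              + D *m (W *m (z - C *m (Q *m (E *m usubmx z))))]].
Proof.
set M := (row_mx E 0)^T; set N := (row_mx A B)^T => sV.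
have EM q (z : 'M[F]_(n + m, q)) : E *m usubmx z = (z^T *m M)^T.
  by rewrite trmx_mul !trmxK -{2}(vsubmxK z) mul_row_col mul0mx addr0.
have NM q (z : 'M[F]_(n + m, q)) : row_mx A B *m z = (z^T *m N)^T.
  by rewrite trmx_mul !trmxK.
pose b := row_base V.
have bV : (b :=: V)%MS by exact: eq_row_base.
have bfree : row_free b by exact: row_base_free.
have [X bX] : exists X, b = X *m (kermx (N *m cokermx V) *m M).
  by apply/submxP; rewrite bV (submx_trans sV) // genmxE.
(* K is a linear section: the rows z of K have z M = b and z N in V *)
pose K := X *m kermx (N *m cokermx V).
have KM : K *m M = b by rewrite bX mulmxA.
have KN : (K *m N <= V)%MS.
  by rewrite submxE -2!mulmxA mulmx_ker mulmx0.
(* Z is the space of the z with z M = 0 and z N in V *)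
pose Z := kermx (row_mx M (N *m cokermx V)).
pose d := row_base Z.
have [dM dN] : d *m M = 0 /\ (d *m N <= V)%MS.
  have : (d <= Z)%MS by rewrite eq_row_base.
  rewrite sub_kermx mul_mx_row -row_mx0 => /eqP/eq_row_mx[-> dN].
  by split=> //; rewrite submxE -mulmxA dN.
have bK (q : nat) (Y : 'M[F]_(q, c)) : (Y <= V)%MS -> Y *m pinvmx b *m b = Y.
  by move=> YV; rewrite mulmxKpV // bV.
(* subtracting from an admissible z its part K determined by E x leaves Z *)
have residual (z : 'cV[F]_(n + m)) :
    ((E *m usubmx z)^T <= V)%MS -> ((row_mx A B *m z)^T <= V)%MS ->
    (z^T - z^T *m M *m pinvmx b *m K <= d)%MS.
  rewrite EM NM !trmxK => zM zN.
  rewrite eq_row_base sub_kermx mul_mx_row -row_mx0; apply/eqP; congr row_mx.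
    by rewrite mulmxBl -[_ *m K *m M]mulmxA KM bK // subrr.
  apply/eqP; rewrite mulmxA -submxE mulmxBl addmx_sub ?eqmx_opp //.
  by rewrite -[_ *m K *m N]mulmxA (submx_trans (submxMl _ _)).
have QT : (pinvmx b)^T *m (E *m usubmx K^T) = 1%:M.
  by apply: trmx_inj; rewrite EM !trmx_mul !trmxK trmx1 KM mulmxVp.
have ABK : row_mx A B *m K^T
    = E *m usubmx K^T *m (K *m N *m pinvmx b)^T.
  by rewrite EM NM !trmxK KM -trmx_mul bK.
(* if Z = 0, the input space is the dummy one-dimensional one *)
have [k0|k_gt0] := posnP (\rank Z).
  exists (\rank V), 1%N, (K *m N *m pinvmx b)^T, 0, K^T, 0, (pinvmx b)^T, 0.
  split=> //; first by left.
    by rewrite linear0 mulmx0.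
  split=> //; first by rewrite !mulmx0.
  move=> z zM zN; rewrite mul0mx addr0; have := residual z zM zN.
  move/eqP: k0; rewrite eq_row_base mxrank_eq0 => /eqP ->.
  rewrite submx0 subr_eq0 => /eqP zE; apply: trmx_inj; rewrite zE.
  by rewrite EM !trmx_mul !trmxK mulmxA.
exists (\rank V), (\rank Z), (K *m N *m pinvmx b)^T, (d *m N *m pinvmx b)^T,
  K^T, d^T, (pinvmx b)^T, (pinvmx d)^T.
split=> //; first by right; rewrite mxrank_tr; exact/eqP/row_base_free.
  by rewrite EM trmxK dM trmx0.
split=> //; first by rewrite EM NM !trmxK KM -trmx_mul bK.
move=> z zM zN; have := residual z zM zN => zd.
apply: trmx_inj; rewrite EM; set r := z - _.
have rE : r^T = z^T - z^T *m M *m pinvmx b *m K.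
  by rewrite /r linearB /= !trmx_mul !trmxK mulmxA.
rewrite linearD /= !trmx_mul !trmxK rE mulmxKpV //.
by rewrite mulmxA addrC subrK.
Qed.
End Algebra.

(** * Absolutely continuous functions with zero derivative *)

(** Cousin's lemma in the form of an induction principle: a property passes
    from a to b if, around each point t, it passes from u to v whenever
    u <= t <= v are close enough to t. *)
Lemma real_induction (R : realType) (P : R -> Prop) (a b : R) :
  a <= b -> P a ->
  (forall t, a <= t <= b -> exists2 d, 0 < d &
     forall u v, a <= u -> u <= t -> t <= v -> v <= b -> t - d < u -> v < t + d ->
       P u -> P v) ->
  P b.
Proof.
move=> ab Pa step; pose S := [set t | a <= t <= b /\ P t].
have Sa : S a by split=> //; rewrite lexx ab.
have ubS : ubound S b by move=> t [/andP[]].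
have supS : has_sup S by split; [exists a|exists b].
have asup : a <= sup S by apply: ub_le_sup => //; exists b.
have supb : sup S <= b by apply: ge_sup => //; exists a.
have [d d0 stepd] := step (sup S) (introT andP (conj asup supb)).
have [u [/andP[au ub] Pu] uS] := sup_adherent d0 supS.
have us : u <= sup S by apply: ub_le_sup; [exists b|split; [rewrite au|]].
pose v := Num.min b (sup S + d / 2).
have sv : sup S <= v by rewrite le_min supb lerDl divr_ge0 // ltW.
have vb : v <= b by rewrite ge_min lexx.
have Pv : P v.
  apply: (stepd u v) => //.
  by rewrite gt_min; apply/orP; right; lra.
have vs : v <= sup S.
  by apply: ub_le_sup; [exists b|split; [rewrite (le_trans asup sv)|]].
suff -> : b = v by [].
move: vs; rewrite /v; case: (leP b) => //= _; lra.
Qed.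

(** Absolute continuity on [a, b] with values in any normed group.  For column
    vectors this is, by conversion, [abs_cont_itv]; the general form also covers
    the scalar components. *)
Definition ac_itv (R : realType) (V : normedZmodType R) (a b : R) (f : R -> V) :=
  forall e : R, 0 < e -> exists2 d : R, 0 < d &
    forall (N : nat) (l r : 'I_N -> R),
      (forall j, a <= l j /\ l j <= r j /\ r j <= b) ->
      trivIset setT (fun j => `]l j, r j[%classic) ->
      \sum_(j < N) (r j - l j) < d ->
      \sum_(j < N) `|f (r j) - f (l j)| < e.

(** The null sets of Lebesgue measure on Borel sets and of its completion are
    the same: in both cases they are the sets of outer measure zero. *)
Lemma leb_negligibleP (R : realType) (N : set R) :
  (@leb R).-negligible N <-> (@lebesgue_measure R).-negligible N.
Proof.
split.
  move=> [A [mA A0 NA]]; apply/negligible_outer_measure/eqP.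
  by rewrite eq_le outer_measure_ge0 andbT -A0 le_outer_measure.
move=> [A [mA A0 NA]]; exists A; split=> //.
exact: sub_caratheodory.
Qed.

Lemma ae_lebP (R : realType) (P : R -> Prop) :
  {ae @leb R, forall t, P t} <-> {ae @lebesgue_measure R, forall t, P t}.
Proof. exact: leb_negligibleP. Qed.

Lemma negligible_open_cover (R : realType) (N : set R) (e : R) : 0 < e ->
  (@leb R).-negligible N ->
  exists U, [/\ open U, N `<=` U & (@lebesgue_measure R U <= e%:E)%E].
Proof.
move=> e0 /leb_negligibleP/negligible_outer_measure N0.
have [U [oU NU]] := outer_measure_open_le N e0.
by rewrite N0 add0e => Ue; exists U.
Qed.

Lemma sum_itv_le_measure (R : realType) (U : set R) (N : nat) (l r : 'I_N -> R) :
  open U -> (forall j, l j <= r j) -> (forall j, `]l j, r j[%classic `<=` U) ->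
  trivIset setT (fun j => `]l j, r j[%classic) ->
  ((\sum_(j < N) (r j - l j))%:E <= @lebesgue_measure R U)%E.
Proof.
move=> oU lr lrU tI; rewrite -sumEFin.
have -> : (\sum_(j < N) (r j - l j)%:E)%E =
    (\sum_(j < N) @lebesgue_measure R `]l j, r j[%classic)%E.
  apply: eq_bigr => j _; rewrite lebesgue_measure_itv /= lte_fin.
  by case: ltP => // rl; rewrite (le_anti (introT andP (conj rl (lr j)))) subrr.
rewrite -measure_bigsetU_ord //=.
apply: le_measure; rewrite ?inE.
- by apply: bigsetU_measurable.
- exact: open_measurable.
- apply: (big_ind (fun A => A `<=` U)) => [x|A B AU BU|j _]; [by []| |exact: lrU].
  by rewrite subUset.
Qed.

Lemma is_derive0_near (R : realType) (f : R -> R) (t e : R) : 0 < e ->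
  is_derive t (1 : R) f 0 -> exists2 d, 0 < d &
    forall s, `|s - t| < d -> `|f s - f t| <= e * `|s - t|.
Proof.
move=> e0 [df Df].
have : h^-1 *: (f (h *: (1 : R) + t) - f t) @[h --> 0^'] --> (0 : R).
  by rewrite -[X in _ --> X]Df; exact: df.
move=> /cvgr0Pnorm_le /(_ e e0) [d /= d0 dP]; exists d => // s std.
have [->|st] := eqVneq s t; first by rewrite !subrr normr0 mulr0.
have := dP (s - t); rewrite /ball_ /= sub0r normrN subr_eq0 => /(_ std st).
rewrite [_ *: 1]mulr1 subrK normrZ normfV.
by rewrite ler_pdivrMl ?normr_gt0 ?subr_eq0 // mulrC.
Qed.

Lemma ac_derive0_eq (R : realType) (f : R -> R) (a b : R) : a <= b ->
  ac_itv a b f ->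
  {ae @leb R, forall t, a < t < b -> is_derive t (1 : R) f 0} ->
  f b = f a.
Proof.
move=> ab acf aeD; apply/eqP; rewrite -subr_eq0 -normr_le0.
apply/ler_addgt0Pr => e e0; rewrite add0r.
have e1_gt0 : 0 < e / 2 / (b - a + 1).
  by rewrite !divr_gt0 // ltr_wpDl ?subr_ge0.
set e1 := e / 2 / _ in e1_gt0.
(* e / 2 is allotted to the increments over the null set N below, e / 2 to the
   slope e1; the + 1 in e1 avoids a division by zero when a = b *)
have [d d0 acd] := acf _ (divr_gt0 e0 (ltr0n _ 2)).
(* the endpoints carry no derivative hypothesis, hence are put into N *)
pose N := ~` [set t | a < t < b -> is_derive t (1 : R) f 0] `|` [set a; b].
have Nneg : (@leb R).-negligible N.
  apply: negligibleU => //; apply/leb_negligibleP.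
  apply/negligibleP; first exact: measurableU.
  exact/countable_lebesgue_measure0/finite_set_countable/finite_set2.
have [U [oU NU Ud]] := negligible_open_cover (divr_gt0 d0 (ltr0n _ 2)) Nneg.
(* P v: up to a small slope e1, the increment of f from a to v is carried by
   finitely many disjoint intervals inside U; new ones are added in front *)
pose P v := exists s : seq (R * R), [/\
  (forall p, p \in s -> [/\ a <= p.1, p.1 <= p.2 & p.2 <= v]),
  (forall p, p \in s -> `]p.1, p.2[%classic `<=` U),
  pairwise (fun p q => q.2 <= p.1) s &
  `|f v - f a| <= e1 * (v - a) + \sum_(p <- s) `|f p.2 - f p.1| ].
have : P b.
  apply: (real_induction (a := a)) => //.
    by exists [::]; split=> //; rewrite big_nil !subrr normr0 mulr0 addr0.
  move=> t /andP[at_ tb].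
  have [Nt|nNt] := pselect (N t).
    have : nbhs t U by apply: open_nbhs_nbhs; split=> //; exact: NU.
    move=> [dl /= dl0 dlU]; exists dl => // u v au ut tv vb du dv.
    move=> [s [s1 s2 s3 s4]]; exists ((u, v) :: s); split.
    - move=> p; rewrite inE => /orP[/eqP -> /=|/s1[? ? pu]].
        by split=> //; exact: le_trans ut tv.
      by split=> //; apply: (le_trans pu); exact: le_trans ut tv.
    - move=> p; rewrite inE => /orP[/eqP -> /=|/s2//] x /=.
      rewrite in_itv /= => /andP[ux xv]; apply: dlU => /=.
      by rewrite ltr_distlC; lra.
    - by rewrite /= s3 andbT; apply/allP => p /s1[].
    - rewrite big_cons /=.
      have : `|f v - f a| <= `|f v - f u| + `|f u - f a|.
        by rewrite -[f v - f a](subrKA (f u)) ler_normD.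
      have : e1 * (u - a) <= e1 * (v - a).
        by rewrite ler_pM2l // lerD2r (le_trans ut tv).
      lra.
  have ft : is_derive t (1 : R) f 0.
    apply: contrapT => nD; apply: (nNt); left => /= H; apply: nD; apply: H.
    have nab : ~ [set a; b] t by move=> tab; apply: (nNt); right.
    rewrite !lt_neqAle at_ tb !andbT; apply/andP; split; apply/eqP => tE; apply: nab.
      by left.
    by right.
  have [dl dl0 dlP] := is_derive0_near e1_gt0 ft.
  exists dl => // u v au ut tv vb du dv [s [s1 s2 s3 s4]]; exists s; split=> //.
    by move=> p /s1[? ? pu]; split=> //; apply: (le_trans pu); exact: le_trans ut tv.
  have vt : `|v - t| = v - t by rewrite ger0_norm // subr_ge0.
  have ut' : `|u - t| = t - u by rewrite distrC ger0_norm // subr_ge0.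
  have := dlP v; rewrite vt => /(_ ltac:(lra)) H1.
  have := dlP u; rewrite ut' => /(_ ltac:(lra)) H2.
  have : `|f v - f a| <= `|f v - f t| + `|f u - f t| + `|f u - f a|.
    have -> : f v - f a = (f v - f t) + (f t - f u) + (f u - f a) by lra.
    rewrite (le_trans (ler_normD _ _)) // lerD2r.
    by rewrite (le_trans (ler_normD _ _)) // [`|f u - _|]distrC.
  lra.
move=> [s [s1 s2 s3 s4]].
have memn (j : 'I_(size s)) : nth (0, 0) s j \in s by exact: mem_nth.
have tI : trivIset setT
    (fun j : 'I_(size s) => `](nth (0, 0) s j).1, (nth (0, 0) s j).2[%classic).
  have lt_dis (i j : 'I_(size s)) x : (i < j)%N ->
      x \in `](nth (0, 0) s i).1, (nth (0, 0) s i).2[ ->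
      x \in `](nth (0, 0) s j).1, (nth (0, 0) s j).2[ -> False.
    move=> ij; rewrite !in_itv /= => /andP[ix _] /andP[_ xj].
    have /pairwiseP -/(_ (0, 0) i j (ltn_ord i) (ltn_ord j) ij) := s3.
    lra.
  move=> i j _ _ [x [/= xi xj]]; apply/val_inj/eqP.
  by case: ltngtP => //= ij; [case: (lt_dis i j x)|case: (lt_dis j i x)].
have := acd (size s) (fun j => (nth (0, 0) s j).1) (fun j => (nth (0, 0) s j).2).
move=> /(_ _ tI) H.
have /H : forall j : 'I_(size s), a <= (nth (0, 0) s j).1 /\
  (nth (0, 0) s j).1 <= (nth (0, 0) s j).2 /\ (nth (0, 0) s j).2 <= b.
  by move=> j; have [] := s1 _ (memn j).
rewrite (big_nth (0, 0)) big_mkord in s4.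
have sl : \sum_(j < size s) ((nth (0, 0) s j).2 - (nth (0, 0) s j).1) < d.
  apply: (@le_lt_trans _ _ (d / 2)); last by lra.
  rewrite -lee_fin; apply: le_trans Ud; apply: sum_itv_le_measure => // j.
    by have [] := s1 _ (memn j).
  exact: s2.
move=> /(_ sl) H2.
have : e1 * (b - a) <= e / 2.
  rewrite /e1 mulrAC -mulrA ler_piMr ?divr_ge0 ?(ltW e0) //.
  by rewrite ler_pdivrMr; lra.
lra.
Qed.

(** * From Lebesgue measurable to Borel functions *)

Lemma leb_measurable (R : realType) (D : set R) :
  @measurable _ (measurableTypeR R) D -> @measurable _ (lebesgueR R) D.
Proof. exact: sub_caratheodory. Qed.

Lemma leb_measurable_itv (R : realType) (i : interval R) :
  @measurable _ (lebesgueR R) [set` i].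
Proof. by apply: leb_measurable; exact: measurable_itv. Qed.

Lemma leb_aeS (R : realType) (P Q : R -> Prop) :
  (forall t, P t -> Q t) ->
  {ae @leb R, forall t, P t} -> {ae @leb R, forall t, Q t}.
Proof. by move=> PQ; apply: negligibleS => t; apply: contra_not => /PQ. Qed.

Lemma leb_aeI (R : realType) (P Q : R -> Prop) :
  {ae @leb R, forall t, P t} -> {ae @leb R, forall t, Q t} ->
  {ae @leb R, forall t, P t /\ Q t}.
Proof.
move=> aeP aeQ; apply: negligibleS (negligibleU aeP aeQ) => t /not_andP[nP|nQ].
  by left.
by right.
Qed.

Lemma leb_measurableE (R : realType) (S : set R) :
  @measurable _ (lebesgueR R) S -> exists B M : set R,
    [/\ @measurable _ (measurableTypeR R) B,
        @measurable _ (measurableTypeR R) M, @lebesgue_measure R M = 0%E &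
        B `<=` S /\ S `<=` B `|` M].
Proof.
move=> mS; have : (completed_algebra_gen (@lebesgue_measure R)).-sigma.-measurable S.
  by rewrite completed_caratheodory_measurable.
rewrite g_sigma_completed_algebra_genE => -[B mB [N [M [mM M0 NM]] <-]].
by exists B, M; split=> //; split=> [x|x [|/NM]]; [left|left|right].
Qed.

Lemma Borel_version (R : realType) (D : set R) (f : R -> R) :
  @measurable _ (measurableTypeR R) D ->
  measurable_fun (T := lebesgueR R) D f ->
  exists g : R -> R, [/\ measurable_fun (T := measurableTypeR R) setT g,
    {ae @leb R, forall t, D t -> g t = f t} & forall t, ~ D t -> g t = 0].
Proof.
move=> mD mf.
(* rationals enumerated by naturals: the superlevel sets at rational heights
   are corrected all at once by the single null set M' *)
pose rat_of n : rat := odflt 0 (unpickle n).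
pose S n := D `&` f @^-1` `]ratr (rat_of n), +oo[%classic.
have mS n : @measurable _ (lebesgueR R) (S n).
  by apply: mf; [exact: leb_measurable|exact: measurable_itv].
have /choice[B /choice[M BM]] n := leb_measurableE (mS n).
pose M' := \bigcup_n M n.
have mM' : @measurable _ (measurableTypeR R) M'.
  by apply: bigcupT_measurable => n; have [] := BM n.
have M'neg : (@leb R).-negligible M'.
  apply/leb_negligibleP/negligible_bigcup => n; have [_ mM M0 _] := BM n.
  exact/negligibleP.
pose g t := if t \in D `\` M' then f t else 0.
exists g; split; last first.
- by move=> t nDt; rewrite /g; case: ifPn => // /set_mem[].
- apply: negligibleS M'neg => t /= H; apply: contrapT => nM; apply: H => Dt.
  by rewrite /g mem_set.
apply: (measurability _ (RGenOInfty.measurableE R)) => _ [_ [x ->] <-].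
rewrite setTI.
have -> : g @^-1` `]x, +oo[%classic =
  \bigcup_(n in [set n | x < ratr (rat_of n)])
    ((B n `\` M') `|` (if ratr (rat_of n) < (0 : R) then ~` (D `\` M') else set0)).
  apply/seteqP; split=> [t /=|t [n /= xn]].
    rewrite in_itv /= andbT => xg.
    have [q] := rat_in_itvoo xg; rewrite in_itv /= => /andP[xq qg].
    exists (pickle q) => /=; first by rewrite /rat_of pickleK.
    rewrite /rat_of pickleK /=; move: qg; rewrite /g.
    case: ifPn => [/set_mem tD qf|/negP tD q0].
      left; split; last by case: tD.
      have [_ _ _ [_]] := BM (pickle q) => /(_ t) [||Mt] //.
        split; first by case: tD.
        by rewrite /= in_itv /= /rat_of pickleK andbT.
      by case: tD => _ []; exists (pickle q).
    by right; rewrite q0 => /mem_set.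
  rewrite in_itv /= andbT; case.
    move=> [Bt Mt]; have [_ _ _ [/(_ t Bt)[Dt]]] := BM n.
    rewrite /= in_itv /= andbT => nf _.
    by rewrite /g mem_set //; exact: lt_trans nf.
  case: ifPn => // n0 tD; rewrite /g ifN; first exact: lt_trans n0.
  by apply/negP => /set_mem.
apply: bigcup_measurable => n _; apply: measurableU.
  by apply: measurableD => //; have [] := BM n.
by case: ifP => // _; apply: measurableC; exact: measurableD.
Qed.

Lemma leb_measurable_fun (R : realType) (D : set R) d (U : measurableType d) (f : R -> U) :
  measurable_fun (T := measurableTypeR R) D f ->
  @measurable _ (measurableTypeR R) D ->
  measurable_fun (T := lebesgueR R) D f.
Proof. by move=> mf mD _ Y mY; apply: leb_measurable; exact: mf. Qed.

(** The integrals of a Borel function for Lebesgue measure and for its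
    completion agree, because the former is the image of the latter under the
    identity map. *)
Lemma ge0_integral_lebE (R : realType) (D : set R) (g : R -> \bar R) :
  @measurable _ (measurableTypeR R) D ->
  measurable_fun (T := measurableTypeR R) D g ->
  (forall t, (0 <= g t)%E) ->
  (\int[@leb R]_(t in D) g t = \int[@lebesgue_measure R]_(t in D) g t)%E.
Proof.
move=> mD mg g0.
have mid : measurable_fun (T := lebesgueR R) (U := measurableTypeR R) setT id.
  by move=> _ Y mY; rewrite setTI preimage_id; exact: leb_measurable.
have := ge0_integral_pushforward mid (@leb R) mD mg (fun t _ => g0 t).
rewrite preimage_id => <-.
by apply: eq_measure_integral.
Qed.

Lemma integrable_lebE (R : realType) (g : R -> R) (D : set R) :
  @measurable _ (measurableTypeR R) D ->
  measurable_fun (T := measurableTypeR R) D g ->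
  (@leb R).-integrable D (EFin \o g) <->
  (@lebesgue_measure R).-integrable D (EFin \o g).
Proof.
move=> mD mg; have mabs : measurable_fun (T := measurableTypeR R) D
    (fun t => `|(EFin \o g) t|)%E.
  by apply: measurableT_comp => //; exact/measurable_EFinP.
split=> /integrableP[_ ig]; apply/integrableP; split.
- exact/measurable_EFinP.
- by rewrite -ge0_integral_lebE.
- by apply: leb_measurable_fun => //; exact/measurable_EFinP.
- by rewrite ge0_integral_lebE.
Qed.

Lemma Rintegral_lebE (R : realType) (g : R -> R) (D : set R) :
  @measurable _ (measurableTypeR R) D ->
  measurable_fun (T := measurableTypeR R) D g ->
  \int[@leb R]_(t in D) g t = \int[@lebesgue_measure R]_(t in D) g t.
Proof.
move=> mD mg; rewrite /Rintegral; congr fine.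
rewrite integralE [RHS]integralE; congr (_ - _)%E; apply: ge0_integral_lebE => //.
  by apply: measurable_funepos; exact/measurable_EFinP.
by apply: measurable_funeneg; exact/measurable_EFinP.
Qed.

(** On [a, b], the primitive of a Lebesgue integrable function is that of a
    Borel integrable function on the whole line. *)
Lemma integrable_Borel_version (R : realType) (f : R -> R) (a b : R) :
  (@leb R).-integrable `[a, b] (EFin \o f) ->
  exists g : R -> R, [/\ (@lebesgue_measure R).-integrable setT (EFin \o g),
    {ae @leb R, forall t, a <= t <= b -> g t = f t} &
    forall t, t <= b ->
      \int[@leb R]_(s in `[a, t]) f s = \int[@lebesgue_measure R]_(s in `[a, t]) g s].
Proof.
move=> intf; have /integrableP[mf foo] := intf.
have mI (c : R) : @measurable _ (lebesgueR R) (`[a, c]%classic).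
  exact: leb_measurable_itv.
have [g [mg gf g0]] := Borel_version (measurable_itv `[a, b])
  ((measurable_EFinP _ _).1 mf).
have mgl : measurable_fun (T := lebesgueR R) setT g.
  by apply: leb_measurable_fun.
exists g; split.
- have -> : EFin \o g = (EFin \o g) \_ `[a, b].
    apply/funext => t /=; rewrite patchE; case: ifPn => // /negP tab.
    by rewrite g0 // => /mem_set.
  rewrite -integrable_mkcond; last exact: measurable_itv.
  apply/integrable_lebE => //; first exact: measurable_funTS.
  apply/integrableP; split.
    exact/measurable_EFinP/measurable_funTS.
  suff -> : (\int[@leb R]_(t in `[a, b]) `|(EFin \o g) t|
      = \int[@leb R]_(t in `[a, b]) `|(EFin \o f) t|)%E by [].
  apply: ae_eq_integral; first exact: mI.
  + by apply: measurableT_comp => //; exact/measurable_EFinP/measurable_funTS.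
  + exact: measurableT_comp.
  + by apply: leb_aeS gf => t gft tab /=; rewrite gft.
- apply: leb_aeS gf => t gft tab; apply: gft.
  by rewrite /= in_itv.
- move=> t tb; rewrite -Rintegral_lebE //; last exact: measurable_funTS.
  congr fine.
  apply: ae_eq_integral; first exact: mI.
  + by apply: measurable_funS mf => //; apply: subset_itvl.
  + by apply/measurable_EFinP; exact: measurable_funTS.
  + apply: leb_aeS gf => s gfs; rewrite /= in_itv /= => /andP[as_ st].
    by rewrite gfs //= in_itv /= as_ (le_trans st).
Qed.

(** * The fundamental theorem of calculus *)

Lemma ac_itv_sub (R : realType) (V : normedZmodType R) (a b : R) (f g : R -> V) :
  ac_itv a b f -> ac_itv a b g -> ac_itv a b (fun t => f t - g t).
Proof.
move=> acf acg e e0; have e2 : 0 < e / 2 by rewrite divr_gt0.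
have [d1 d10 H1] := acf _ e2; have [d2 d20 H2] := acg _ e2.
exists (Num.min d1 d2); first by rewrite lt_min d10.
move=> N l r lr tI; rewrite lt_min => /andP[/(H1 _ _ _ lr tI) S1 /(H2 _ _ _ lr tI) S2].
apply: le_lt_trans (_ : _ <= \sum_(j < N) `|f (r j) - f (l j)|
                         + \sum_(j < N) `|g (r j) - g (l j)|) _; last lra.
rewrite -big_split /=; apply: ler_sum => j _.
by rewrite opprD opprK addrACA [- g _ + _]addrC -[g _ - _]opprB normrN ler_normD.
Qed.

Lemma ac_itv_eq (R : realType) (V : normedZmodType R) (a b : R) (f g : R -> V) :
  (forall t, a <= t <= b -> f t = g t) -> ac_itv a b f -> ac_itv a b g.
Proof.
move=> fg acf e e0; have [d d0 H] := acf _ e0; exists d => // N l r lr tI S.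
have := H N l r lr tI S; congr (_ < _); apply: eq_bigr.
by move=> j _; have [? [? ?]] := lr j; rewrite !fg //; apply/andP; split; lra.
Qed.

(** The sum of the increments of the primitive over disjoint intervals is at
    most the integral of |g| over their union, which has small measure. *)
Lemma ac_primitive_Borel (R : realType) (g : R -> R) (a b : R) :
  (@lebesgue_measure R).-integrable setT (EFin \o g) ->
  ac_itv a b (fun t => \int[@lebesgue_measure R]_(s in `[a, t]) g s).
Proof.
set mu := @lebesgue_measure R => ig e e0.
have igS (D : set R) : @measurable _ (measurableTypeR R) D -> mu.-integrable D (EFin \o g).
  by move=> mD; apply: integrableS ig.
have igN (D : set R) : @measurable _ (measurableTypeR R) D ->
    mu.-integrable D (EFin \o (fun x => `|g x|)).
  move=> mD; have := integrable_norm (igS _ mD).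
  by [].
have [d [d0 dP]] := integral_normr_continuous ig e0; exists d => // N l r lr tI sd.
pose D := \big[setU/set0]_(j < N) `]l j, r j[%classic.
have mD : @measurable _ (measurableTypeR R) D by apply: bigsetU_measurable.
have muD : (mu D < d%:E)%E.
  rewrite /D /mu measure_bigsetU_ord //=.
  rewrite (eq_bigr (fun j => (r j - l j)%:E)) ?sumEFin ?lte_fin // => j _.
  rewrite lebesgue_measure_itv /= lte_fin; have [_ [ljr _]] := lr j.
  by case: ltP => // rl; rewrite (le_anti (introT andP (conj rl ljr))) subrr.
apply: le_lt_trans (dP _ mD muD).
have -> : \int[mu]_(x in D) `|g x| = \sum_(j < N) \int[mu]_(x in `]l j, r j[) `|g x|.
  rewrite /Rintegral integral_bigsetU_EFin ?index_enum_uniq //; last first.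
  - exact: (measurable_int mu (igN _ mD)).
  - by apply: sub_trivIset tI.
  rewrite -sum_fine // => j _.
  by apply: integrable_fin_num => //; exact: igN.
apply: ler_sum => j _; have [al [ljr rb]] := lr j.
have -> : \int[mu]_(x in `]l j, r j[) `|g x| = \int[mu]_(x in `]l j, r j]) `|g x|.
  by rewrite (Rintegral_itv_bndo_bndc (f := fun x => `|g x|)) //; exact: igN.
rewrite Rintegral_itvB ?bnd_simp //; last exact: igS.
by apply: le_normr_Rintegral => //; exact: igS.
Qed.

Lemma ac_primitive (R : realType) (f : R -> R) (a b : R) :
  (@leb R).-integrable `[a, b] (EFin \o f) ->
  ac_itv a b (fun t => \int[@leb R]_(s in `[a, t]) f s).
Proof.
move=> /integrable_Borel_version[g [ig _ Fg]].
apply: (ac_itv_eq _ (ac_primitive_Borel _ _ ig)) => t /andP[_ /Fg]; exact: esym.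
Qed.

(** Lebesgue's differentiation theorem for the completed measure. *)
Lemma primitive_is_derive (R : realType) (f : R -> R) (a b : R) :
  (@leb R).-integrable `[a, b] (EFin \o f) ->
  {ae @leb R, forall t, a < t < b ->
     is_derive t (1 : R) (fun t => \int[@leb R]_(s in `[a, t]) f s) (f t)}.
Proof.
move=> /integrable_Borel_version[g [ig gf Fg]].
have locg : locally_integrable setT g.
  by have := integrable_locally measurableT ig; rewrite patch_setT.
have igS (y : R) : (@lebesgue_measure R).-integrable
    [set` Interval (BLeft a) (BRight y)] (EFin \o g) by exact: integrableS ig.
have /ae_lebP dG := FTC1 igS locg.
apply: leb_aeS (leb_aeI gf dG) => t [gft dGt] /andP[at_ tb].
have [|dt Dt] := dGt _; first by rewrite /= lte_fin.
apply: near_eq_is_derive (_ : is_derive t (1 : R)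
   (fun x => \int[lebesgue_measure]_(t in [set` Interval (BLeft a) (BRight x)]) g t) (f t)).
  exists (b - t) => /=; first by rewrite subr_gt0.
  by move=> x /=; rewrite ltr_distlC => /andP[_ xb]; rewrite Fg //; lra.
by split=> //; rewrite -derive1E Dt gft // !ltW.
Qed.

(** Fundamental theorem of calculus for absolutely continuous functions: h and
    the primitive of f are both absolutely continuous with derivative f almost
    everywhere, so their difference is constant. *)
Lemma ac_ftc (R : realType) (h f : R -> R) (a b : R) : a <= b ->
  (@leb R).-integrable `[a, b] (EFin \o f) -> ac_itv a b h ->
  {ae @leb R, forall t, a < t < b -> is_derive t (1 : R) h (f t)} ->
  h b = h a + \int[@leb R]_(s in `[a, b]) f s.
Proof.
move=> ab intf ach dh.
set F := fun t => \int[@leb R]_(s in `[a, t]) f s.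
have := @ac_derive0_eq _ (fun t => h t - F t) _ _ ab (ac_itv_sub ach (ac_primitive intf)).
have Fa : F a = 0.
  have [g [_ _ Fg]] := integrable_Borel_version intf.
  by rewrite /F Fg // set_itv1 Rintegral_set1.
rewrite Fa subr0 => <-; first by rewrite subrK.
apply: leb_aeS (leb_aeI dh (primitive_is_derive intf)) => t [ht Ft] tab.
by rewrite -(subrr (f t)); apply: is_deriveB; [exact: ht|exact: Ft].
Qed.

(** * Vector-valued functions on time intervals *)

Section Vec.
Variable R : realType.

Lemma mx_norm_coord (q : nat) (v : 'cV[R]_q) (i : 'I_q) : `|v i 0| <= `|v|.
Proof.
rewrite [leRHS]/Num.Def.normr/= mx_normrE.
exact: (le_bigmax _ (fun i : 'I_q * 'I_1 => `|v i.1 i.2|) (i, 0)).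
Qed.

Lemma mx_norm_mulmx (q p : nat) (M : 'M[R]_(p, q)) (v : 'cV[R]_q) :
  `|M *m v| <= (\sum_(i < p) \sum_(j < q) `|M i j|) * `|v|.
Proof.
have S0 i : 0 <= \sum_(j < q) `|M i j| by apply: sumr_ge0.
rewrite [leLHS]/Num.Def.normr/= mx_normrE; apply: bigmax_le => [|[i k] _ /=].
  by rewrite mulr_ge0 // sumr_ge0.
rewrite mxE (le_trans (ler_norm_sum _ _ _)) //.
apply: (@le_trans _ _ ((\sum_(j < q) `|M i j|) * `|v|)).
  rewrite mulr_suml ler_sum // => j _.
  by rewrite normrM ler_wpM2l // (ord1 k) mx_norm_coord.
by rewrite ler_wpM2r // (bigD1 i) //= lerDl sumr_ge0.
Qed.

Lemma ac_itv_lipschitz (V W : normedZmodType R) (k a b : R) (f : R -> V) (g : R -> W) :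
  (forall s t, `|g s - g t| <= k * `|f s - f t|) -> ac_itv a b f -> ac_itv a b g.
Proof.
move=> gf acf e e0.
have k1 : 0 < `|k| + 1 by rewrite ltr_wpDl.
have [d d0 H] := acf _ (divr_gt0 e0 k1); exists d => // N l r lr tI sd.
have := H N l r lr tI sd; rewrite ltr_pdivlMr // => /(le_lt_trans _); apply.
rewrite mulr_suml ler_sum // => j _; rewrite (le_trans (gf _ _)) // mulrC.
by rewrite ler_wpM2l // (le_trans (ler_norm _)) // lerDl.
Qed.

Lemma ac_itv_coord (q : nat) (a b : R) (f : R -> 'cV[R]_q) (i : 'I_q) :
  ac_itv a b f -> ac_itv a b (fun t => f t i 0).
Proof.
apply: (ac_itv_lipschitz (k := 1)) => s t; rewrite mul1r.
by have := mx_norm_coord (f s - f t) i; rewrite !mxE.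
Qed.

Lemma abs_cont_mulmx (I : set R) (p q : nat) (M : 'M[R]_(p, q)) (f : R -> 'cV[R]_q) :
  abs_cont I f -> abs_cont I (fun t => M *m f t).
Proof.
move=> acf a b abI.
apply: (ac_itv_lipschitz (k := \sum_(i < p) \sum_(j < q) `|M i j|)) (acf a b abI).
by move=> s t; rewrite -mulmxBr mx_norm_mulmx.
Qed.

Lemma is_derive_colP (q : nat) (f : R -> 'cV[R]_q) (t : R) (v : 'cV[R]_q) :
  is_derive t (1 : R) f v <->
  forall i, is_derive t (1 : R) (fun s => f s i 0) (v i 0).
Proof.
split=> [[df Df] i|H].
  split; first by have /derivable_mxP := df; apply.
  by rewrite -Df derive_mx // mxE.
have df : derivable f t 1.
  by apply/derivable_mxP => i j; rewrite (ord1 j); have [] := H i.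
split=> //; rewrite derive_mx //; apply/matrixP => i j.
by rewrite mxE (ord1 j); have [] := H i.
Qed.

Lemma is_derive_mulmx (p q : nat) (M : 'M[R]_(p, q)) (f : R -> 'cV[R]_q) t v :
  is_derive t (1 : R) f v -> is_derive t (1 : R) (fun s => M *m f s) (M *m v).
Proof.
move=> /is_derive_colP df; apply/is_derive_colP => i; rewrite mxE.
have -> : (fun s => (M *m f s) i 0) = \sum_(j < q) (M i j \*: (fun s => f s j 0)).
  by apply/funext => s; rewrite mxE fct_sumE.
by apply: is_derive_sum => j; apply: is_deriveZ.
Qed.

(** A time interval is a countable union of nondegenerate segments, which
    reduces global statements to statements on segments. *)
Lemma time_interval_exhaustion (I : set R) : time_interval I ->
  exists a b : nat -> R, [/\ forall n, a n < b n,
    forall n, `[a n, b n]%classic `<=` I & I `<=` \bigcup_n `[a n, b n]%classic].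
Proof.
have nat_ge (t : R) : exists n : nat, t <= n%:R.
  exists (Num.truncn `|t|).+1; rewrite (le_trans (ler_norm _)) // ltW //.
  exact: truncnS_gt.
case=> [->|[a ->]|[a ->]|[a [b [ab ->]]]].
- exists (fun n => - n.+1%:R), (fun n => n.+1%:R); split=> // [n|t _].
    by rewrite gtrN.
  have [n tn] := nat_ge `|t|; exists n => //=.
  by rewrite in_itv /= -ler_norml (le_trans tn) // ler_nat.
- exists (fun=> a), (fun n => a + n.+1%:R); split=> // [n|n t|t] /=.
  + by rewrite ltrDl.
  + by rewrite !in_itv /= andbT => /andP[].
  + rewrite in_itv /= andbT => at_; have [n tn] := nat_ge (t - a); exists n => //=.
    by rewrite in_itv /= at_ -lerBlDl (le_trans tn) // ler_nat.
- exists (fun n => a - n.+1%:R), (fun=> a); split=> // [n|n t|t] /=.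
  + by rewrite ltrBlDr ltrDl.
  + by rewrite !in_itv /= => /andP[].
  + rewrite in_itv /= => ta; have [n tn] := nat_ge (a - t); exists n => //=.
    by rewrite in_itv /= ta andbT lerBlDr -lerBlDl (le_trans tn) // ler_nat.
- by exists (fun=> a), (fun=> b); split=> [n|n|t tab] //; exists 0%N.
Qed.

Lemma time_interval_segment (I : set R) (s t : R) :
  time_interval I -> I s -> I t -> `[s, t]%classic `<=` I.
Proof.
case=> [->|[a ->]|[a ->]|[a [b [_ ->]]]] //= sI tI r /=; move: sI tI;
  rewrite !in_itv /= ?andbT => sI tI /andP[sr rt].
- exact: le_trans sr.
- exact: le_trans tI.
- by have /andP[? _] := sI; have /andP[_ ?] := tI; apply/andP; split; lra.
Qed.

(** A property holds almost everywhere on I if it does so in the interior of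
    each segment of I; the countably many endpoints are negligible. *)
Lemma ae_time_interval (I : set R) (P : R -> Prop) : time_interval I ->
  (forall a b, a < b -> `[a, b]%classic `<=` I ->
    {ae @leb R, forall t, a < t < b -> P t}) ->
  {ae @leb R, forall t, I t -> P t}.
Proof.
move=> /time_interval_exhaustion[a [b [ab abI Iab]]] aeP.
have N1 : (@leb R).-negligible
    (\bigcup_n ~` [set t | a n < t < b n -> P t]).
  by apply: negligible_bigcup => n; exact: aeP.
have N2 : (@leb R).-negligible (\bigcup_n [set a n; b n]).
  apply: negligible_bigcup => n; apply/leb_negligibleP/negligibleP.
    exact: measurableU.
  exact/countable_lebesgue_measure0/finite_set_countable/finite_set2.
apply: negligibleS (negligibleU N1 N2) => t /= /not_implyP[It nP].
have [n _] := Iab _ It; rewrite /= in_itv /= => /andP[at_ tb].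
have [tE|tN] := pselect ([set a n; b n] t); first by right; exists n.
left; exists n => //= H; apply: nP; apply: H.
rewrite !lt_neqAle at_ tb !andbT; apply/andP; split; apply/eqP => tE; apply: tN.
  by left.
by right.
Qed.

Lemma L1loc_mulmx (I : set R) (p q : nat) (M : 'M[R]_(p, q)) (f : R -> 'cV[R]_q) :
  L1loc I f -> L1loc I (fun t => M *m f t).
Proof.
move=> Lf i.
have E t : (M *m f t) i 0 = \sum_(j < q) M i j * f t j 0 by rewrite mxE.
split.
  under eq_fun do rewrite E.
  apply: measurable_sum => j; apply: measurable_funM; first exact: measurable_cst.
  by have [] := Lf j.
move=> a b abI.
have -> : (fun t => ((M *m f t) i 0)%:E) =
    (fun t => \sum_(j < q) (M i j)%:E * (f t j 0)%:E)%E.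
  by apply/funext => t; rewrite E -sumEFin.
apply: integrable_sum; first exact: leb_measurable_itv.
move=> j _; apply: integrableZl; first exact: leb_measurable_itv.
by have [_] := Lf j; apply.
Qed.

Lemma L1locD (I : set R) (q : nat) (f g : R -> 'cV[R]_q) :
  L1loc I f -> L1loc I g -> L1loc I (fun t => f t + g t).
Proof.
move=> Lf Lg i; have [mf intf] := Lf i; have [mg intg] := Lg i.
have E t : (f t + g t) i 0 = f t i 0 + g t i 0 by rewrite mxE.
split; first by under eq_fun do rewrite E; exact: measurable_funD.
move=> a b abI.
have -> : (fun t => ((f t + g t) i 0)%:E) =
    ((fun t => (f t i 0)%:E) \+ (fun t => (g t i 0)%:E))%E.
  by apply/funext => t; rewrite E.
apply: integrableD; [exact: leb_measurable_itv|exact: intf|exact: intg].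
Qed.

Lemma L1loc_col_mx (I : set R) (p q : nat) (f : R -> 'cV[R]_p) (g : R -> 'cV[R]_q) :
  L1loc I f -> L1loc I g -> L1loc I (fun t => col_mx (f t) (g t)).
Proof.
move=> Lf Lg.
have E t : col_mx (f t) (g t) = col_mx 1%:M 0 *m f t + col_mx 0 1%:M *m g t.
  by rewrite !mul_col_mx !mul1mx !mul0mx add_col_mx addr0 add0r.
rewrite (funext E); exact: L1locD (L1loc_mulmx _ Lf) (L1loc_mulmx _ Lg).
Qed.

Lemma ac_itv_uniform (V : normedZmodType R) (a b : R) (f : R -> V) (e : R) :
  ac_itv a b f -> 0 < e -> exists2 d, 0 < d &
    forall s t, a <= s <= b -> a <= t <= b -> `|s - t| < d -> `|f s - f t| < e.
Proof.
move=> acf e0; have [d d0 H] := acf _ e0; exists d => // s t.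
wlog st : s t / s <= t => [W|/andP[as_ _] /andP[_ tb]].
  by case: (leP s t) => [|/ltW] st sab tab; [|rewrite distrC [`|f s - _|]distrC]; apply: W.
rewrite distrC ger0_norm ?subr_ge0 // => std; rewrite distrC.
have := H 1%N (fun=> s) (fun=> t) (fun=> conj as_ (conj st tb)).
rewrite !big_ord1; apply=> //.
by move=> i j _ _ _; rewrite (ord1 i) (ord1 j).
Qed.

Lemma ac_itv_continuous (a b : R) (f : R -> R) :
  ac_itv a b f -> {within `[a, b], continuous f}.
Proof.
move=> acf; apply/subspace_continuousP => x xab.
apply/cvgrPdist_lt => e e0; have [d d0 H] := ac_itv_uniform acf e0.
exists d => //= t xt; rewrite /= !in_itv /= in xab * => tab; exact: H.
Qed.

(** Absolutely continuous functions are continuous on each segment of I, hence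
    measurable on the countable union of segments and integrable on each. *)
Lemma abs_cont_L1loc (I : set R) (q : nat) (p : R -> 'cV[R]_q) :
  time_interval I -> abs_cont I p -> L1loc I p.
Proof.
move=> /time_interval_exhaustion[a [b [ab abI Iab]]] acp i.
have cont c d : `[c, d]%classic `<=` I -> {within `[c, d], continuous (fun t => p t i 0)}.
  by move=> cdI; apply/ac_itv_continuous/ac_itv_coord/acp.
split.
  have -> : I = \bigcup_n `[a n, b n]%classic.
    by apply/seteqP; split=> // t [n _ /abI].
  apply/measurable_fun_bigcup => n; first exact: leb_measurable_itv.
  apply: leb_measurable_fun; last exact: measurable_itv.
  by apply: subspace_continuous_measurable_fun; [exact: measurable_itv|exact: cont].
move=> c d cdI.
have icd : (@lebesgue_measure R).-integrable `[c, d] (EFin \o (fun t => p t i 0)).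
  by apply: continuous_compact_integrable; [exact: segment_compact|exact: cont].
apply/integrable_lebE => //.
by apply/measurable_EFinP; case/integrableP: icd.
Qed.

Lemma ac_col_ftc (q : nat) (y v : R -> 'cV[R]_q) (a b : R) : a <= b ->
  abs_cont_itv a b y ->
  (forall i, (@leb R).-integrable `[a, b] (fun t => (v t i 0)%:E)) ->
  {ae @leb R, forall t, a < t < b -> is_derive t (1 : R) y (v t)} ->
  y b = y a + vintegral `[a, b] v.
Proof.
move=> ab acy intv dy; apply/colP => i; rewrite !mxE.
apply: (ac_ftc (h := fun t => y t i 0) (f := fun t => v t i 0)) => //;
  [exact: intv|exact: ac_itv_coord|].
by apply: leb_aeS dy => t dyt /dyt/is_derive_colP.
Qed.

Lemma ae_all_ord (q : nat) (P : 'I_q -> R -> Prop) :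
  (forall i, {ae @leb R, forall t, P i t}) ->
  {ae @leb R, forall t, forall i, P i t}.
Proof.
move=> aeP.
have N : (@leb R).-negligible
    (\big[setU/set0]_(i < q) ~` [set t | P i t]).
  elim/big_ind : _ => [|A B|i _]; [exact: negligible_set0|exact: negligibleU|].
  exact: aeP.
apply: negligibleS N => t /existsNP[i nP].
by rewrite -bigcup_seq; exists i => //=; rewrite mem_index_enum.
Qed.

Lemma vintegral_is_derive (I : set R) (q : nat) (y v : R -> 'cV[R]_q) :
  time_interval I -> L1loc I v ->
  (forall t0 t, I t0 -> I t -> t0 <= t -> y t = y t0 + vintegral `[t0, t] v) ->
  {ae @leb R, forall t, I t -> is_derive t (1 : R) y (v t)}.
Proof.
move=> tI Lv yE; apply: ae_time_interval => // a b ab abI.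
have /ae_all_ord := fun i => primitive_is_derive ((Lv i).2 a b abI).
apply: leb_aeS => t dF tab; apply/is_derive_colP => i.
have Ia : I a by apply: abI; rewrite /= in_itv /= lexx ltW.
have /andP[at_ tb] := tab.
apply: near_eq_is_derive (_ : is_derive t (1 : R)
    (fun s => y a i 0 + \int[@leb R]_(r in `[a, s]) (v r i 0)) (v t i 0)); last first.
  by rewrite -[v t i 0]add0r; apply: is_deriveD; exact: dF.
exists (Num.min (t - a) (b - t)) => /=; first by rewrite lt_min !subr_gt0 at_.
move=> s /=; rewrite lt_min !ltr_distlC => /andP[/andP[sa _] /andP[_ sb]].
rewrite (yE a s) //; [by rewrite !mxE| |lra].
by apply: abI; rewrite /= in_itv /=; apply/andP; split; lra.
Qed.

(** By continuity, and because the segments of I through t are nondegenerate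
    even when t is an endpoint of I. *)
Lemma ae_eq0_abs_cont (I : set R) (q : nat) (y : R -> 'cV[R]_q) :
  time_interval I -> abs_cont I y ->
  {ae @leb R, forall t, I t -> y t = 0} -> forall t, I t -> y t = 0.
Proof.
move=> /time_interval_exhaustion[a [b [ab abI Iab]]] acy y0 t It.
have [n _] := Iab t It; rewrite /= in_itv /= => tab; have /andP[at_ tb] := tab.
apply: contrapT => /eqP; rewrite -normr_gt0 => yt.
have [d d0 H] := ac_itv_uniform (acy _ _ (abI n)) yt.
pose l := Num.max (a n) (t - d); pose r := Num.min (b n) (t + d).
have lr : l < r by rewrite lt_min !gt_max ab /=; apply/andP; split; [|apply/andP; split]; lra.
have : (@lebesgue_measure R).-negligible `]l, r[.
  apply/leb_negligibleP; apply: negligibleS y0 => s /=; rewrite in_itv /=.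
  rewrite lt_min gt_max => /andP[/andP[sa std] /andP[sb sdt]] ys.
  have sab : a n <= s <= b n by rewrite !ltW.
  have ys0 : y s = 0 by apply: ys; apply: (abI n); rewrite /= in_itv.
  have := H t s tab sab; rewrite ys0 subr0 ltxx => /(_ _)/negP; apply=> //.
  by rewrite ltr_distlC; lra.
move/negligibleP => /(_ (measurable_itv _)) mu0.
have {mu0} : @lebesgue_measure R `]l, r[%classic = 0%E by exact: mu0.
rewrite lebesgue_measure_itv /= lte_fin lr => /eqP; rewrite -EFinB eqe.
by rewrite subr_eq0 => /eqP lrE; move: lr; rewrite lrE ltxx.
Qed.

Lemma submx_cokerP (q : nat) (V : 'M[R]_q) (y : 'cV[R]_q) :
  (y^T <= V)%MS <-> (cokermx V)^T *m y = 0.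
Proof.
rewrite submxE -trmx_eq0 trmx_mul trmxK; split=> [/eqP //|->]; exact: eqxx.
Qed.

Lemma abs_cont_ae_subspace (I : set R) (q : nat) (V : 'M[R]_q) (y : R -> 'cV[R]_q) :
  time_interval I -> abs_cont I y ->
  {ae @leb R, forall t, I t -> ((y t)^T <= V)%MS} ->
  forall t, I t -> ((y t)^T <= V)%MS.
Proof.
move=> tI acy yV t It; apply/submx_cokerP.
apply: (ae_eq0_abs_cont tI (abs_cont_mulmx (cokermx V)^T acy)) => //.
by apply: leb_aeS yV => s ysV /ysV/submx_cokerP.
Qed.

Lemma is_derive_subspace (I : set R) (q : nat) (V : 'M[R]_q) (y v : R -> 'cV[R]_q) :
  time_interval I -> (forall t, I t -> ((y t)^T <= V)%MS) ->
  {ae @leb R, forall t, I t -> is_derive t (1 : R) y (v t)} ->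
  {ae @leb R, forall t, I t -> ((v t)^T <= V)%MS}.
Proof.
move=> tI yV dy; apply: ae_time_interval => // a b ab abI.
apply: leb_aeS dy => t dyt tab; have /andP[at_ tb] := tab.
have It : I t by apply: abI; rewrite /= in_itv /= !ltW.
apply/submx_cokerP.
have [_ <-] := is_derive_mulmx (cokermx V)^T (dyt It).
suff [_ ->] : is_derive t (1 : R) (fun s => (cokermx V)^T *m y s) 0 by [].
apply: near_eq_is_derive (is_derive_cst 0 t 1).
exists (Num.min (t - a) (b - t)) => /=; first by rewrite lt_min !subr_gt0 at_.
move=> s /=; rewrite lt_min !ltr_distlC => /andP[/andP[sa _] /andP[_ sb]].
apply/esym/submx_cokerP/yV/abI; rewrite /= in_itv /=; apply/andP; split; lra.
Qed.

End Vec.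

(** * The associated ODE *)

Section Main.
Variable R : realType.
Variables (c n m : nat) (E A : 'M[R]_(c, n)) (B : 'M[R]_(c, m)).

(** V contains the values of E x(t), written as row vectors, for all solutions
    on all time intervals. *)
Definition consistent (V : 'M[R]_c) : Prop :=
  forall I, time_interval I -> forall xu, dae_solutions I E A B xu ->
  forall t, I t -> ((E *m xu.1 t)^T <= V)%MS.

Lemma dae_rhs_L1loc (I : set R) (x : R -> 'cV[R]_n) (u : R -> 'cV[R]_m) :
  L1loc I x -> L1loc I u -> L1loc I (fun t => A *m x t + B *m u t).
Proof. by move=> Lx Lu; apply: L1locD; exact: L1loc_mulmx. Qed.

Lemma dae_is_derive (I : set R) xu : time_interval I -> dae_solutions I E A B xu ->
  {ae @leb R, forall t, I t ->
    is_derive t (1 : R) (fun t => E *m xu.1 t) (A *m xu.1 t + B *m xu.2 t)}.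
Proof.
move=> tI [Lx Lu acE xE].
apply: (vintegral_is_derive (v := fun t => A *m xu.1 t + B *m xu.2 t)).
- exact: tI.
- exact: dae_rhs_L1loc.
- exact: xE.
Qed.

Lemma dae_rhs_sub (V : 'M[R]_c) (I : set R) xu :
  consistent V -> time_interval I -> dae_solutions I E A B xu ->
  {ae @leb R, forall t, I t -> ((A *m xu.1 t + B *m xu.2 t)^T <= V)%MS}.
Proof.
move=> CV tI sol; apply: (is_derive_subspace (y := fun t => E *m xu.1 t)) => //.
  by move=> t; exact: CV.
exact: dae_is_derive.
Qed.

Lemma consistent_pred_space (V : 'M[R]_c) : consistent V ->
  consistent (V :&: pred_space (row_mx E 0 : 'M[R]_(c, n + m))^T (row_mx A B)^T V)%MS.
Proof.
move=> CV I tI xu sol t It; rewrite sub_capmx (CV _ tI _ sol) //=.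
have [_ _ acE _] := sol.
apply: (abs_cont_ae_subspace tI acE) It.
apply: leb_aeS (dae_rhs_sub CV tI sol) => s rV Is.
have -> : (E *m xu.1 s)^T = (col_mx (xu.1 s) (xu.2 s))^T *m (row_mx E 0)^T.
  by rewrite -trmx_mul mul_row_col mul0mx addr0.
by apply: sub_pred_space; rewrite -trmx_mul mul_row_col rV.
Qed.

Lemma exists_consistent_space : exists V : 'M[R]_c, consistent V /\
  (V <= pred_space (row_mx E 0 : 'M[R]_(c, n + m))^T (row_mx A B)^T V)%MS.
Proof.
apply: exists_invariant_space; first by move=> I tI xu sol t It; exact: submx1.
exact: consistent_pred_space.
Qed.

End Main.

Theorem theorem2 (R : realType) (c n m : nat) (E A : 'M[R]_(c, n))
    (B : 'M[R]_(c, m)) :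
  exists (nh k : nat) (S : odeLTI R nh k (n + m)), associated E A B S.
Proof.
have [V [CV sV]] := exists_consistent_space E A B.
have [nh [k [Al [Bl [C [D [Q [W [k0 rD EDs QEC [ABC ABD zE]]]]]]]]]] :=
  realization_matrices sV.
(* E C_s has full column rank because Q is a left inverse of it *)
have rEC : \rank (E *m usubmx C) = nh.
  apply/eqP; rewrite eqn_leq rank_leq_col /=.
  by rewrite -{1}(mxrank1 R nh) -QEC mxrankM_maxr.
have ABCD (p : 'cV_nh) (w : 'cV_k) :
    row_mx A B *m (C *m p + D *m w) = E *m usubmx C *m (Al *m p + Bl *m w).
  by rewrite !mulmxDr !mulmxA ABC ABD.
exists nh, k, (OdeLTI Al Bl C D); split=> //=.
  split=> //; rewrite -rEC (leq_trans (mxrankM_maxr _ _)) //.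
  exact: rank_leq_row.
move=> I tI; split=> [_ [[x u] sol <-] /=|p w [/= acp Lw dp]].
  (* from the DAE to the ODE *)
  have [/= Lx Lu acE _] := sol.
  pose p t := Q *m (E *m x t).
  pose w t := W *m (col_mx (x t) (u t) - C *m p t).
  have acp : abs_cont I p by exact: abs_cont_mulmx.
  have zCD : {ae @leb R, forall t, I t -> col_mx (x t) (u t) = C *m p t + D *m w t}.
    apply: leb_aeS (dae_rhs_sub CV tI sol) => t rV It.
    have := zE (col_mx (x t) (u t)); rewrite col_mxKu mul_row_col; apply.
      exact: (CV _ tI _ sol).
    exact: rV.
  exists p, w; split; last exact: zCD.
  split=> /=; first exact: acp.
    apply: L1loc_mulmx; under eq_fun do rewrite -mulNmx; apply: L1locD.
      exact: L1loc_col_mx.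
    exact/L1loc_mulmx/abs_cont_L1loc.
  apply: leb_aeS (leb_aeI zCD (dae_is_derive tI sol)) => t [zt dt] It.
  have := is_derive_mulmx Q (dt It).
  by rewrite -mul_row_col (zt It) ABCD mulmxA QEC mul1mx.
(* from the ODE to the DAE: the output itself, and not only a function equal to
   it almost everywhere, is a solution *)
pose z t := C *m p t + D *m w t.
have Lz : L1loc I z 
  by apply: L1locD; apply: L1loc_mulmx; [exact: abs_cont_L1loc|exact: Lw].
have Ez t : E *m usubmx (z t) = E *m usubmx C *m p t.
  by rewrite linearD /= -!mul_usub_mx mulmxDr !mulmxA EDs mul0mx addr0.
have ABz t : A *m usubmx (z t) + B *m dsubmx (z t)
    = E *m usubmx C *m (Al *m p t + Bl *m w t).
  by rewrite -mul_row_col vsubmxK ABCD.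
have Lsub : L1loc I (fun t => usubmx (z t)) /\ L1loc I (fun t => dsubmx (z t)).
  split.
    have -> : (fun t => usubmx (z t)) = (fun t => usubmx 1%:M *m z t).
      by apply/funext => t; rewrite mul_usub_mx mul1mx.
    exact: L1loc_mulmx.
  have -> : (fun t => dsubmx (z t)) = (fun t => dsubmx 1%:M *m z t).
    by apply/funext => t; rewrite mul_dsub_mx mul1mx.
  exact: L1loc_mulmx.
have acEz : abs_cont I (fun t => E *m usubmx (z t)).
  rewrite (funext Ez); exact: abs_cont_mulmx.
exists z; split; last first.
  by apply: aeW.
exists ((fun t => usubmx (z t)), (fun t => dsubmx (z t))) => /=; last first.
  by apply/funext => t; rewrite vsubmxK.
case: Lsub => Lx Lu; split=> //= t0 t It0 It t0t.
have t0tI : `[t0, t]%classic `<=` I by exact: time_interval_segment.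
apply: (ac_col_ftc (y := fun t => E *m usubmx (z t))
  (v := fun t => A *m usubmx (z t) + B *m dsubmx (z t))) => //.
- exact: acEz.
- by move=> i; have [_] := dae_rhs_L1loc A B Lx Lu i; apply.
apply: leb_aeS dp => s dps /andP[t0s st]; rewrite ABz (funext Ez).
apply: is_derive_mulmx; apply: dps; apply: t0tI.
by rewrite /= in_itv /= !ltW.
Qed.
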